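(* In every model for $\mathbf{ZF+CC}$, there exists a gts $X$ such that $X\neq X_{pt}$, while both $X$ and its partial topologization $X_{pt}$ are simultaneously weakly locally small and not locally small.
   Context: $\mathbf{ZF+CC}$ is $\mathbf{ZF}$ together with the axiom of countable choice $\mathbf{CC}$ (every countable product of non-empty sets is non-empty). A generalized topological space in the sense of Delfs and Knebusch (gts) is a triple $(X,\mathrm{Op}_X,\mathrm{Cov}_X)$ where $X$ is a set, $\mathrm{Op}_X\subseteq\mathcal{P}(X)$, $\mathrm{Cov}_X\subseteq\mathcal{P}(\mathrm{Op}_X)$ and: (1) if $\mathcal{U}\subseteq\mathrm{Op}_X$ is finite, then $\bigcup\mathcal{U}\in\mathrm{Op}_X$, $\bigcap\mathcal{U}\in\mathrm{Op}_X$ and $\mathcal{U}\in\mathrm{Cov}_X$ (where $\bigcap\varnothing=X$); (2) if $\mathcal{U}\in\mathrm{Cov}_X$ and $V\in\mathrm{Op}_X$, then $\{U\cap V:U\in\mathcal{U}\}\in\mathrm{Cov}_X$; (3) if $\mathcal{U}\in\mathrm{Cov}_X$ and, for each $U\in\mathcal{U}$, we have $\mathcal{V}(U)\in\mathrm{Cov}_X$ with $\bigcup\mathcal{V}(U)=U$, then $\bigcup_{U\in\mathcal{U}}\mathcal{V}(U)\in\mathrm{Cov}_X$; (4) if $\mathcal{U}\subseteq\mathrm{Op}_X$ and $\mathcal{V}\in\mathrm{Cov}_X$ are such that $\bigcup\mathcal{V}=\bigcup\mathcal{U}$ and for each $V\in\mathcal{V}$ there is $U\in\mathcal{U}$ with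 $V\subseteq U$, then $\mathcal{U}\in\mathrm{Cov}_X$; (5) if $\mathcal{U}\in\mathrm{Cov}_X$, $V\subseteq\bigcup\mathcal{U}$ and $V\cap U\in\mathrm{Op}_X$ for each $U\in\mathcal{U}$, then $V\in\mathrm{Op}_X$. Then $\mathrm{Op}_X=\bigcup\mathrm{Cov}_X$, so the gts is identified with $(X,\mathrm{Cov}_X)$, and also denoted by $X$; $\mathrm{Cov}_X$ is called a generalized topology in $X$. For $\Psi\subseteq\mathcal{P}(\mathcal{P}(X))$, $\langle\Psi\rangle_X$ is the smallest generalized topology in $X$ containing $\Psi$. For a collection $\mathcal{A}$ of subsets of $X$, $\tau(\mathcal{A})$ is the weakest topology in $X$ containing $\mathcal{A}$, and $\mathrm{EssFin}(\mathcal{A})$ is the collection of all $\mathcal{U}\subseteq\mathcal{A}$ for which there is a finite $\mathcal{V}\subseteq\mathcal{U}$ with $\bigcup\mathcal{V}=\bigcup\mathcal{U}$. The partial topologization of $X$ is the gts $X_{pt}=(X,\tau(\mathrm{Op}_X),\langle\mathrm{Cov}_X\cup\mathrm{EssFin}(\tau(\mathrm{Op}_X))\rangle_X)$. A set $K\subseteq X$ is small in the gts $X$ if for each $\mathcal{U}\in\mathrm{Cov}_X$ there is a finite $\mathcal{V}\subseteq\mathcal{U}$ with $K\cap\bigcup\mathcal{U}\subseteq\bigcup\mathcal{V}$. $\mathbf{Sm}(X)$ is the collection of all small sets in $X$. A gts $X$ is locally small if there is $\mathcal{U}\in\mathrm{Cov}_X$ with $\mathcal{U}\subseteq\mathbf{Sm}(X)$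 and $X=\bigcup\mathcal{U}$. It is weakly locally small if there is a collection $\mathcal{U}\subseteq\mathrm{Op}_X\cap\mathbf{Sm}(X)$ with $X=\bigcup\mathcal{U}$. *)

(* Defs.v *)
(* "In every model of ZF + CC" is rendered with first-order models: a model is
   a type with a binary relation (and genuine equality), the schemas range over
   the deeply embedded first-order formulas of the language {=, ∈}, and every
   notion below (finite, countable, function, gts, ...) is the interpretation in
   the model M of its set-theoretic definition: all quantifiers range over the
   elements of M.  In particular "finite" is finiteness in the sense of M.
   Operations such as unions and pairs are relational, because the language of
   set theory has no function symbols. *)

Set Implicit Arguments.

Record set_structure : Type := SetStructure {
  carrier :> Type;
  mem : carrier -> carrier -> Prop
}.

Notation "x ∈ y" := (mem _ x y) (at level 70, no associativity).

(* De Bruijn indices: under a quantifier, index 0 is the bound variable. *)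
Inductive formula : Type :=
  | FEq (i j : nat)
  | FMem (i j : nat)
  | FFalse
  | FImp (p q : formula)
  | FAnd (p q : formula)
  | FOr (p q : formula)
  | FAll (p : formula)
  | FEx (p : formula).

Definition scons (T : Type) (x : T) (e : nat -> T) (i : nat) : T :=
  match i with O => x | S j => e j end.

Fixpoint sat (M : set_structure) (e : nat -> M) (p : formula) : Prop :=
  match p with
  | FEq i j => e i = e j
  | FMem i j => e i ∈ e j
  | FFalse => False
  | FImp p q => sat M e p -> sat M e q
  | FAnd p q => sat M e p /\ sat M e q
  | FOr p q => sat M e p \/ sat M e q
  | FAll p => forall x : M, sat M (scons x e) p
  | FEx p => exists x : M, sat M (scons x e) p
  end.

Section SetTheory.

Context {M : set_structure}.

Implicit Types a b c d e f g i n p s u v w x y z : M.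
Implicit Types A B C E I K O P S T U V W X : M.

Definition subset A B : Prop := forall x, x ∈ A -> x ∈ B.

Definition is_empty e : Prop := forall x, ~ x ∈ e.

Definition is_upair p a b : Prop := forall x, x ∈ p <-> x = a \/ x = b.

(* Kuratowski's {{a}, {a, b}} *)
Definition is_opair p a b : Prop :=
  exists s d, is_upair s a a /\ is_upair d a b /\ is_upair p s d.

Definition is_union s U : Prop := forall x, x ∈ s <-> exists u, u ∈ U /\ x ∈ u.

(* The intersection of a family U of subsets of X; it is X when U is empty. *)
Definition is_inter_in X s U : Prop :=
  forall x, x ∈ s <-> x ∈ X /\ forall u, u ∈ U -> x ∈ u.

Definition is_cup c a b : Prop := forall x, x ∈ c <-> x ∈ a \/ x ∈ b.

Definition is_cap c a b : Prop := forall x, x ∈ c <-> x ∈ a /\ x ∈ b.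

Definition is_power P A : Prop := forall x, x ∈ P <-> subset x A.

Definition is_succ s n : Prop := forall x, x ∈ s <-> x ∈ n \/ x = n.

Definition inductive_set w : Prop :=
  (exists e, is_empty e /\ e ∈ w) /\
  (forall n s, n ∈ w -> is_succ s n -> s ∈ w).

Definition is_omega w : Prop :=
  inductive_set w /\ forall v, inductive_set v -> subset w v.

Definition app f x y : Prop := exists p, p ∈ f /\ is_opair p x y.

Definition is_function f A B : Prop :=
  (forall p, p ∈ f -> exists x y, x ∈ A /\ y ∈ B /\ is_opair p x y) /\
  (forall x, x ∈ A -> exists! y, app f x y).

Definition is_injection f A B : Prop :=
  is_function f A B /\ forall x x' y, app f x y -> app f x' y -> x = x'.

Definition is_bijection f A B : Prop :=
  is_injection f A B /\ forall y, y ∈ B -> exists x, app f x y.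

(* equipotent with a von Neumann natural number *)
Definition finite_set A : Prop :=
  exists w n f, is_omega w /\ n ∈ w /\ is_bijection f n A.

Definition countable_set A : Prop :=
  exists w f, is_omega w /\ is_injection f A w.

End SetTheory.

Record ZF (M : set_structure) : Prop := {
  zf_extensionality :
    forall a b : M, (forall x : M, x ∈ a <-> x ∈ b) -> a = b;
  zf_pairing :
    forall a b : M, exists p : M, is_upair p a b;
  zf_union :
    forall U : M, exists s : M, is_union s U;
  zf_power :
    forall A : M, exists P : M, is_power P A;
  zf_infinity :
    exists w : M, inductive_set w;
  zf_foundation :
    forall A : M, (exists x : M, x ∈ A) ->
    exists x : M, x ∈ A /\ forall y : M, y ∈ x -> ~ y ∈ A;
  zf_separation :
    forall (phi : formula) (e : nat -> M) (A : M),
    exists B : M, forall x : M, x ∈ B <-> x ∈ A /\ sat M (scons x e) phi;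
  zf_replacement :
    forall (phi : formula) (e : nat -> M),
    (forall x y z : M, sat M (scons x (scons y e)) phi ->
                       sat M (scons x (scons z e)) phi -> y = z) ->
    forall A : M, exists B : M, forall y : M,
      y ∈ B <-> exists x : M, x ∈ A /\ sat M (scons x (scons y e)) phi
}.

(* The elements of the product of the values f(i), for i in I, are the
   functions g on I with g(i) ∈ f(i). *)
Definition countable_choice (M : set_structure) : Prop :=
  forall I B f : M, countable_set I -> is_function f I B ->
  (forall i a : M, app f i a -> exists x : M, x ∈ a) ->
  exists C g : M, is_function g I C /\
    forall i a x : M, app f i a -> app g i x -> x ∈ a.

(* A triple (X, Op_X, Cov_X) of sets of the model M. *)
Record triple (M : set_structure) : Type := Triple {
  space : M;
  opens : M;
  covers : M
}.

Section GTS.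

Context {M : set_structure}.

Implicit Types A C E K O P S T U V W X : M.

Record is_gts (G : triple M) : Prop := {
  gts_opens_subset :
    forall U, U ∈ opens G -> subset U (space G);
  gts_covers_subset :
    forall U, U ∈ covers G -> subset U (opens G);
  gts_finite :
    forall U, subset U (opens G) -> finite_set U ->
      (forall s : M, is_union s U -> s ∈ opens G) /\
      (forall s : M, is_inter_in (space G) s U -> s ∈ opens G) /\
      U ∈ covers G;
  gts_restrict :
    forall U V W, U ∈ covers G -> V ∈ opens G ->
      (forall w : M, w ∈ W <-> exists u : M, u ∈ U /\ is_cap w u V) ->
      W ∈ covers G;
  (* f is the assignment U ↦ V(U) *)
  gts_transitive :
    forall U f W, U ∈ covers G -> is_function f U (covers G) ->
      (forall u v : M, app f u v -> is_union u v) ->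
      (forall w : M, w ∈ W <-> exists u v : M, app f u v /\ w ∈ v) ->
      W ∈ covers G;
  gts_saturated :
    forall U V, subset U (opens G) -> V ∈ covers G ->
      (exists s : M, is_union s V /\ is_union s U) ->
      (forall v : M, v ∈ V -> exists u : M, u ∈ U /\ subset v u) ->
      U ∈ covers G;
  gts_regular :
    forall U V, U ∈ covers G ->
      (forall x : M, x ∈ V -> exists u : M, u ∈ U /\ x ∈ u) ->
      (forall u w : M, u ∈ U -> is_cap w V u -> w ∈ opens G) ->
      V ∈ opens G
}.

(* C is a generalized topology in X; O is then the union of C. *)
Definition generalized_topology X C : Prop :=
  exists O, is_gts (Triple M X O C).

(* C = ⟨P⟩_X *)
Definition is_generated_gtop X P C : Prop :=
  generalized_topology X C /\ subset P C /\
  forall C', generalized_topology X C' -> subset P C' -> subset C C'.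

Definition topology X T : Prop :=
  (forall U, U ∈ T -> subset U X) /\
  X ∈ T /\
  (forall U V W, U ∈ T -> V ∈ T -> is_cap W U V -> W ∈ T) /\
  (forall U s, subset U T -> is_union s U -> s ∈ T).

(* T = τ(A) *)
Definition is_generated_topology X A T : Prop :=
  topology X T /\ subset A T /\
  forall T', topology X T' -> subset A T' -> subset T T'.

(* E = EssFin(A) *)
Definition is_ess_fin E A : Prop :=
  forall U, U ∈ E <->
    subset U A /\
    exists V, subset V U /\ finite_set V /\
      exists s : M, is_union s V /\ is_union s U.

(* H = G_pt *)
Definition is_partial_topologization (G H : triple M) : Prop :=
  space H = space G /\
  is_generated_topology (space G) (opens G) (opens H) /\
  exists E P, is_ess_fin E (opens H) /\ is_cup P (covers G) E /\
    is_generated_gtop (space G) P (covers H).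

Definition small (G : triple M) K : Prop :=
  subset K (space G) /\
  forall U, U ∈ covers G ->
  exists V, subset V U /\ finite_set V /\
    forall x : M, x ∈ K -> (exists u : M, u ∈ U /\ x ∈ u) ->
      exists v : M, v ∈ V /\ x ∈ v.

Definition locally_small (G : triple M) : Prop :=
  exists U, U ∈ covers G /\ (forall u : M, u ∈ U -> small G u) /\
    is_union (space G) U.

Definition weakly_locally_small (G : triple M) : Prop :=
  exists U, (forall u : M, u ∈ U -> u ∈ opens G /\ small G u) /\
    is_union (space G) U.

End GTS.

(* Main.v *)
Require Import Defs.
From Stdlib Require Import Classical ClassicalEpsilon Arith.

(** Let [Y] be an infinite set and [Z] a set, disjoint from [Y], of finite sets
    that cover [Y]; for instance [Y] is the set of natural numbers and [Z] the
    set of all pairs {Y, a} with [a] in [Y].  On the union of [Y] and [Z], let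
    [T] be the topology of the sets that contain, with each [z] in [Z], also the
    elements of [z] in [Y].  A family of open sets is admissible when finitely
    many of its members cover the part of its union that lies in [Z]: it is
    unrestricted over [Y], and finite in essence over [Z].

    Every point has a finite open neighbourhood, and finite sets are small, so
    the space is weakly locally small.  The singletons of points of [Y] form an
    admissible family; hence a small set has finite trace on [Y].  If an
    admissible family of small open sets covered the space, finitely many of its
    members would cover [Z], and, being open, they would contain every point of
    [Y]; then [Y] would be finite ([not_locally_small]).

    This argument works for the family [T] of open sets, and also for the family
    [O] that consists of the whole space and of the members of [T] with finite
    trace on [Z].  The latter is not closed under unions, and generates [T].
    The gts given by [O] is therefore the required one, once it is known that
    its partial topologization is the gts given by [T], that is, that the
    admissible families of the latter are generated
    ([attached_covers_generated]).  The reason is that an admissible family [U]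
    splits its union into the union [B] of a finite subfamily and a rest [A]
    contained in [Y], which is the union of an admissible family of singletons.
    Gluing over the finite cover {A, B} gives a refinement of [U].

    All sets here have to be sets of the model, so that every comprehension and
    every induction is over a predicate definable by a formula with parameters.
    Definability is closed under the logical operations, which makes it
    a matter of syntax to verify.  The remaining tool is induction over the
    sets that are finite in the sense of the model ([finite_ind]). *)

(** * Definability with parameters *)

Section Definability.

Context {M : set_structure}.

Definition lift_renaming (r : nat -> nat) (i : nat) : nat :=
  match i with O => O | S j => S (r j) end.

Fixpoint rename (r : nat -> nat) (p : formula) : formula :=
  match p with
  | FEq i j => FEq (r i) (r j)
  | FMem i j => FMem (r i) (r j)
  | FFalse => FFalse
  | FImp p q => FImp (rename r p) (rename r q)
  | FAnd p q => FAnd (rename r p) (rename r q)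
  | FOr p q => FOr (rename r p) (rename r q)
  | FAll p => FAll (rename (lift_renaming r) p)
  | FEx p => FEx (rename (lift_renaming r) p)
  end.

(** Substitution lemma; the two environments are only compared pointwise, so
    that it also says that satisfaction respects pointwise equality. *)
Lemma sat_rename p : forall (r : nat -> nat) (e e' : nat -> M),
  (forall i, e (r i) = e' i) -> (sat M e (rename r p) <-> sat M e' p).
Proof.
  assert (Hl : forall (r : nat -> nat) (e e' : nat -> M) x,
    (forall i, e (r i) = e' i) ->
    forall i, scons x e (lift_renaming r i) = scons x e' i).
  { intros r e e' x H [|i]; simpl; auto. }
  induction p as [i j|i j| |p IHp q IHq|p IHp q IHq|p IHp q IHq|p IHp|p IHp];
    intros r e e' H; simpl.
  - rewrite !H; tauto.
  - rewrite !H; tauto.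
  - tauto.
  - rewrite (IHp r e e' H), (IHq r e e' H); tauto.
  - rewrite (IHp r e e' H), (IHq r e e' H); tauto.
  - rewrite (IHp r e e' H), (IHq r e e' H); tauto.
  - split; intros H1 x; apply (IHp _ _ _ (Hl r e e' x H)), H1.
  - split; intros [x H1]; exists x; apply (IHp _ _ _ (Hl r e e' x H)), H1.
Qed.

(** An assignment [rho] interprets a variable of a formula either as an entry
    of an environment or as a parameter. *)
Definition assigned (rho : nat -> nat + M) (e : nat -> M) (i : nat) : M :=
  match rho i with inl j => e j | inr m => m end.

(** Definability with parameters of a predicate of finitely many variables,
    the variables being the entries of an environment.  Predicates on
    environments make the closure properties below apply by mere unification:
    the bound variable of a quantifier becomes the entry 0. *)
Definition edefinable (P : (nat -> M) -> Prop) : Prop :=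
  exists phi rho, forall e, P e <-> sat M (assigned rho e) phi.

Definition eterm (t : (nat -> M) -> M) : Prop :=
  (exists i, forall e, t e = e i) \/ (exists m, forall e, t e = m).

Lemma eterm_var i : eterm (fun e => e i).
Proof. left; exists i; reflexivity. Qed.

Lemma eterm_param (m : M) : eterm (fun _ => m).
Proof. right; exists m; reflexivity. Qed.

Lemma eterm_code t : eterm t ->
  exists c : nat + M, forall e, t e = match c with inl j => e j | inr m => m end.
Proof.
  intros [[i H]|[m H]]; [exists (inl i)|exists (inr m)]; exact H.
Qed.

Lemma edefinable_eq s t : eterm s -> eterm t -> edefinable (fun e => s e = t e).
Proof.
  intros Hs Ht.
  destruct (eterm_code s Hs) as [c Hc], (eterm_code t Ht) as [d Hd].
  exists (FEq 0 1), (fun i => match i with O => c | S _ => d end).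
  intros e; simpl; unfold assigned; rewrite Hc, Hd; tauto.
Qed.

Lemma edefinable_mem s t : eterm s -> eterm t -> edefinable (fun e => s e ∈ t e).
Proof.
  intros Hs Ht.
  destruct (eterm_code s Hs) as [c Hc], (eterm_code t Ht) as [d Hd].
  exists (FMem 0 1), (fun i => match i with O => c | S _ => d end).
  intros e; simpl; unfold assigned; rewrite Hc, Hd; tauto.
Qed.

Lemma edefinable_False : edefinable (fun _ => False).
Proof. exists FFalse, (fun i => inl i); simpl; tauto. Qed.

(** Two formulas with different assignments are put over a common one by
    moving their variables to the even and to the odd positions. *)
Lemma edefinable_common P Q : edefinable P -> edefinable Q ->
  exists phi psi rho, forall e,
    (P e <-> sat M (assigned rho e) phi) /\ (Q e <-> sat M (assigned rho e) psi).
Proof.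
  intros (phi & r1 & H1) (psi & r2 & H2).
  exists (rename (fun i => 2 * i) phi), (rename (fun i => S (2 * i)) psi),
    (fun i => if Nat.even i then r1 (Nat.div2 i) else r2 (Nat.div2 i)).
  intros e; split.
  - rewrite H1; symmetry; apply sat_rename; intros i; unfold assigned.
    rewrite Nat.even_mul, Nat.div2_double; reflexivity.
  - rewrite H2; symmetry; apply sat_rename; intros i; unfold assigned.
    rewrite Nat.even_succ, Nat.odd_mul, Nat.div2_succ_double; reflexivity.
Qed.

Lemma edefinable_and P Q :
  edefinable P -> edefinable Q -> edefinable (fun e => P e /\ Q e).
Proof.
  intros HP HQ; destruct (edefinable_common P Q HP HQ) as (phi & psi & rho & H).
  exists (FAnd phi psi), rho; intros e; simpl; destruct (H e); tauto.
Qed.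

Lemma edefinable_or P Q :
  edefinable P -> edefinable Q -> edefinable (fun e => P e \/ Q e).
Proof.
  intros HP HQ; destruct (edefinable_common P Q HP HQ) as (phi & psi & rho & H).
  exists (FOr phi psi), rho; intros e; simpl; destruct (H e); tauto.
Qed.

Lemma edefinable_imp P Q :
  edefinable P -> edefinable Q -> edefinable (fun e => P e -> Q e).
Proof.
  intros HP HQ; destruct (edefinable_common P Q HP HQ) as (phi & psi & rho & H).
  exists (FImp phi psi), rho; intros e; simpl; destruct (H e); tauto.
Qed.

Lemma edefinable_not P : edefinable P -> edefinable (fun e => ~ P e).
Proof. intros H; apply edefinable_imp; [exact H|exact edefinable_False]. Qed.

Lemma edefinable_iff P Q :
  edefinable P -> edefinable Q -> edefinable (fun e => P e <-> Q e).
Proof. intros HP HQ; apply edefinable_and; apply edefinable_imp; assumption. Qed.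

(** All variables of the formula that are assigned to the entry 0 become the
    bound variable, and the other entries are shifted down. *)
Lemma edefinable_bind (P : M -> (nat -> M) -> Prop) :
  edefinable (fun e => P (e 0) (fun i => e (S i))) ->
  exists phi rho, forall e x, P x e <-> sat M (scons x (assigned rho e)) phi.
Proof.
  intros (phi & rho & H).
  exists (rename (fun i => match rho i with inl O => O | _ => S i end) phi).
  exists (fun i => match rho i with inl (S j) => inl j | c => c end).
  intros e x; rewrite (H (scons x e) : P x e <-> _).
  symmetry; apply sat_rename; intros i; unfold assigned.
  destruct (rho i) as [[|j]|m] eqn:E; simpl; rewrite ?E; reflexivity.
Qed.

Lemma edefinable_all (P : M -> (nat -> M) -> Prop) :
  edefinable (fun e => P (e 0) (fun i => e (S i))) ->
  edefinable (fun e => forall x, P x e).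
Proof.
  intros HP; destruct (edefinable_bind P HP) as (phi & rho & H).
  exists (FAll phi), rho; intros e; split; intros H1 x; apply H, H1.
Qed.

Lemma edefinable_ex (P : M -> (nat -> M) -> Prop) :
  edefinable (fun e => P (e 0) (fun i => e (S i))) ->
  edefinable (fun e => exists x, P x e).
Proof.
  intros HP; destruct (edefinable_bind P HP) as (phi & rho & H).
  exists (FEx phi), rho; intros e; split; intros [x H1]; exists x; apply H, H1.
Qed.

Definition definable (P : M -> Prop) : Prop := edefinable (fun e => P (e 0)).

Lemma edefinable_app P t :
  definable P -> eterm t -> edefinable (fun e => P (t e)).
Proof.
  intros (phi & rho & H) Ht; destruct (eterm_code t Ht) as [c Hc].
  exists phi, (fun i => match rho i with
                        | inl O => c | inl (S j) => inl j | inr m => inr m end).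
  intros e; rewrite (H (scons (t e) e) : P (t e) <-> _).
  rewrite <- (sat_rename phi (fun i => i) _ _ (fun i => eq_refl)).
  apply sat_rename; intros i; unfold assigned.
  destruct (rho i) as [[|j]|m]; simpl; auto.
Qed.

End Definability.

Ltac eterm_tac := first [apply eterm_param | apply eterm_var].

(* The implication must be tried before the universal quantifier, of which it
   is a degenerate case. *)
Ltac definability_step :=
  lazymatch goal with
  | |- edefinable (fun e => _ /\ _) => apply edefinable_and
  | |- edefinable (fun e => _ \/ _) => apply edefinable_or
  | |- edefinable (fun e => _ <-> _) => apply edefinable_iff
  | |- edefinable (fun e => ~ _) => apply edefinable_not
  | |- edefinable (fun e => False) => apply edefinable_False
  | |- edefinable (fun e => exists x, _) => apply edefinable_ex; cbv beta
  | |- edefinable (fun e => _ = _) => apply edefinable_eq; eterm_tac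
  | |- edefinable (fun e => mem _ _ _) => apply edefinable_mem; eterm_tac
  | H : definable ?P |- edefinable (fun e => ?P _) =>
      apply (edefinable_app P _ H); eterm_tac
  | |- edefinable (fun e => forall x, _) =>
      first [ apply edefinable_imp | apply edefinable_all; cbv beta ]
  end.

Ltac definability :=
  unfold definable; repeat progress (unfold unique, finite_set, is_bijection,
    is_injection, is_function, is_omega, inductive_set, is_succ, is_cap, is_cup,
    is_union, app, is_opair, is_upair, is_empty, subset);
  repeat definability_step.

(** * Elementary sets *)

Section Model.

Context {M : set_structure} (hZF : ZF M).

Implicit Types a b c d e f g i n p s u v w x y z : M.
Implicit Types A B C E I K O P S T U V W X : M.

Definition sep A (Q : M -> Prop) : M :=
  epsilon (inhabits A) (fun B => forall x, x ∈ B <-> x ∈ A /\ Q x).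

Definition upair a b : M := epsilon (inhabits a) (fun p => is_upair p a b).

Definition union_of U : M := epsilon (inhabits U) (fun s => is_union s U).

Definition power A : M := epsilon (inhabits A) (fun P => is_power P A).

Definition cup a b : M := union_of (upair a b).

Definition cap a b : M := sep a (fun x => x ∈ b).

Definition adjoin A x : M := cup A (upair x x).

Definition opair a b : M := upair (upair a a) (upair a b).

Lemma in_sep A (Q : M -> Prop) x :
  definable Q -> (x ∈ sep A Q <-> x ∈ A /\ Q x).
Proof.
  intros (phi & rho & H); unfold sep; revert x.
  apply epsilon_spec.
  (* The entries other than 0 of the variable environment are immaterial, and
     filled with A. *)
  destruct (zf_separation hZF
    (rename (fun i : nat => match rho i with inl O => O | _ => S i end) phi)
    (fun i : nat => match rho i with inl _ => A | inr m => m end) A) as [B HB].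
  exists B; intros x; rewrite HB.
  rewrite (H (scons x (fun _ => A)) : Q x <-> _).
  rewrite (sat_rename phi _ _ (assigned rho (scons x (fun _ => A)))).
  - tauto.
  - intros i; unfold assigned.
    destruct (rho i) as [[|j]|m] eqn:E; simpl; rewrite ?E; reflexivity.
Qed.

Lemma in_upair a b x : x ∈ upair a b <-> x = a \/ x = b.
Proof.
  exact (epsilon_spec (inhabits a) (fun p => is_upair p a b)
    (zf_pairing hZF a b) x).
Qed.

Lemma in_union_of U x : x ∈ union_of U <-> exists u, u ∈ U /\ x ∈ u.
Proof.
  exact (epsilon_spec (inhabits U) (fun s => is_union s U) (zf_union hZF U) x).
Qed.

Lemma in_power A x : x ∈ power A <-> subset x A.
Proof.
  exact (epsilon_spec (inhabits A) (fun P => is_power P A) (zf_power hZF A) x).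
Qed.

Lemma in_cup a b x : x ∈ cup a b <-> x ∈ a \/ x ∈ b.
Proof.
  unfold cup; rewrite in_union_of; split.
  - intros (u & Hu & Hx); apply in_upair in Hu; destruct Hu; subst; auto.
  - intros [H|H]; eexists; (split; [apply in_upair|exact H]); auto.
Qed.

Lemma in_cap a b x : x ∈ cap a b <-> x ∈ a /\ x ∈ b.
Proof. apply (in_sep a (fun x => x ∈ b)); definability. Qed.

Lemma in_adjoin A x y : y ∈ adjoin A x <-> y ∈ A \/ y = x.
Proof. unfold adjoin; rewrite in_cup, in_upair; tauto. Qed.

Lemma extensionality a b : (forall x, x ∈ a <-> x ∈ b) -> a = b.
Proof. apply (zf_extensionality hZF). Qed.

Lemma is_cap_eq w a b : is_cap w a b -> w = cap a b.
Proof. intros H; apply extensionality; intros x; rewrite in_cap; apply H. Qed.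

Lemma is_union_eq s U : is_union s U -> s = union_of U.
Proof.
  intros H; apply extensionality; intros x; rewrite in_union_of; apply H.
Qed.

Lemma is_upair_eq p a b : is_upair p a b -> p = upair a b.
Proof. intros H; apply extensionality; intros x; rewrite in_upair; apply H. Qed.

Lemma is_opair_iff p a b : is_opair p a b <-> p = opair a b.
Proof.
  split.
  - intros (s & d & Hs & Hd & Hp).
    rewrite (is_upair_eq _ _ _ Hp), (is_upair_eq _ _ _ Hs),
      (is_upair_eq _ _ _ Hd); reflexivity.
  - intros ->; exists (upair a a), (upair a b).
    repeat split; apply in_upair.
Qed.

Lemma opair_inj a b c d : opair a b = opair c d -> a = c /\ b = d.
Proof.
  intros E.
  assert (H : forall z, (z = upair a a \/ z = upair a b) <->
                        (z = upair c c \/ z = upair c d)).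
  { intros z; rewrite <- !in_upair; fold (opair a b) (opair c d); rewrite E; tauto. }
  assert (L : forall u v w z, upair u v = upair w z ->
    (w = u \/ w = v) /\ (z = u \/ z = v) /\ (u = w \/ u = z) /\ (v = w \/ v = z)).
  { intros u v w z Ez; rewrite <- !in_upair; rewrite Ez at 1 2;
    rewrite <- Ez at 3 4; rewrite !in_upair; tauto. }
  pose proof (proj1 (H _) (or_introl eq_refl)) as H1.
  pose proof (proj1 (H _) (or_intror eq_refl)) as H2.
  pose proof (proj2 (H _) (or_intror eq_refl)) as H3.
  assert (a = c) as ->.
  { destruct H1 as [H1|H1]; apply L in H1; intuition congruence. }
  split; [reflexivity|].
  destruct H2 as [H2|H2]; apply L in H2; destruct H3 as [H3|H3]; apply L in H3;
    intuition congruence.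
Qed.

Lemma app_iff f x y : app f x y <-> opair x y ∈ f.
Proof.
  split.
  - intros (p & Hp & E); apply is_opair_iff in E; subst; exact Hp.
  - intros H; exists (opair x y); split; [exact H|apply is_opair_iff; reflexivity].
Qed.

Lemma not_in_self x : ~ x ∈ x.
Proof.
  intros H.
  destruct (zf_foundation hZF (upair x x)) as (y & Hy & Hm).
  { exists x; apply in_upair; auto. }
  apply in_upair in Hy; assert (y = x) as -> by tauto.
  apply (Hm x H), in_upair; auto.
Qed.

Lemma not_in_cycle x y : x ∈ y -> ~ y ∈ x.
Proof.
  intros H1 H2.
  destruct (zf_foundation hZF (upair x y)) as (z & Hz & Hm).
  { exists x; apply in_upair; auto. }
  apply in_upair in Hz; destruct Hz; subst z.
  - apply (Hm y H2), in_upair; auto.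
  - apply (Hm x H1), in_upair; auto.
Qed.

Lemma empty_ex : exists a, is_empty a.
Proof.
  destruct (zf_infinity hZF) as [w ((a & Ha & _) & _)]; exists a; exact Ha.
Qed.

Lemma is_empty_eq a b : is_empty a -> is_empty b -> a = b.
Proof.
  intros Ha Hb; apply extensionality; intros x; split; intros H;
    [destruct (Ha x H)|destruct (Hb x H)].
Qed.

(** * Natural numbers and finite sets *)

Lemma omega_ex : exists w, is_omega w.
Proof.
  destruct (zf_infinity hZF) as [w Hw].
  set (Q := fun x => forall v, inductive_set v -> x ∈ v).
  assert (HQ : definable Q) by (unfold Q; definability).
  exists (sep w Q); split; [split|].
  - destruct Hw as [(a & Ha & Haw) _]; exists a; split; [exact Ha|].
    apply in_sep; [exact HQ|split; [exact Haw|]].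
    intros v [(b & Hb & Hbv) _]; rewrite (is_empty_eq a b Ha Hb); exact Hbv.
  - intros n s Hn Hs; apply in_sep in Hn; [|exact HQ]; destruct Hn as [Hn Hv].
    apply in_sep; [exact HQ|split].
    + apply (proj2 Hw n s Hn Hs).
    + intros v Hiv; apply (proj2 Hiv n s (Hv v Hiv) Hs).
  - intros v Hv x Hx; apply in_sep in Hx; [|exact HQ]; apply (proj2 Hx v Hv).
Qed.

Lemma is_succ_adjoin n : is_succ (adjoin n n) n.
Proof. intros x; apply in_adjoin. Qed.

Lemma succ_in_omega w n : is_omega w -> n ∈ w -> adjoin n n ∈ w.
Proof. intros [[_ H] _] Hn; apply (H n _ Hn), is_succ_adjoin. Qed.

Lemma omega_ind w (Q : M -> Prop) : is_omega w -> definable Q ->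
  (forall a, is_empty a -> Q a) ->
  (forall n, n ∈ w -> Q n -> Q (adjoin n n)) ->
  forall n, n ∈ w -> Q n.
Proof.
  intros Hw HQ H0 HS n Hn.
  assert (Hi : inductive_set (sep w Q)).
  { split.
    - destruct Hw as [[(a & Ha & Haw) _] _]; exists a; split; [exact Ha|].
      apply in_sep; [exact HQ|]; split; [exact Haw|exact (H0 a Ha)].
    - intros m s Hm Hs; apply in_sep in Hm; [|exact HQ]; destruct Hm as [Hm Qm].
      assert (s = adjoin m m) as ->.
      { apply extensionality; intros x; rewrite in_adjoin; apply Hs. }
      apply in_sep; [exact HQ|].
      split; [apply succ_in_omega; assumption|exact (HS m Hm Qm)]. }
  apply (proj2 Hw _ Hi) in Hn; apply in_sep in Hn; [|exact HQ]; apply Hn.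
Qed.

Lemma finite_empty a : is_empty a -> finite_set a.
Proof.
  intros Ha; destruct omega_ex as [w Hw].
  destruct (proj1 (proj1 Hw)) as (z & Hz & Hzw).
  rewrite (is_empty_eq a z Ha Hz); exists w, z, z.
  split; [exact Hw|split; [exact Hzw|split; [split; [split|]|]]].
  - intros p Hp; destruct (Hz p Hp).
  - intros x Hx; destruct (Hz x Hx).
  - intros x x' y (p & Hp & _); destruct (Hz p Hp).
  - intros y Hy; destruct (Hz y Hy).
Qed.

(** Adding one element to a set in bijection with [n]: the bijection is
    extended by sending [n], which is not an element of itself, to it. *)
Lemma finite_adjoin A x : finite_set A -> finite_set (adjoin A x).
Proof.
  intros HA; destruct (classic (x ∈ A)) as [Hx|Hx].
  { replace (adjoin A x) with A; [exact HA|].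
    apply extensionality; intros y; rewrite in_adjoin; intuition congruence. }
  destruct HA as (w & n & f & Hw & Hn & ((Hf & Hv) & Hi) & Hs).
  assert (Hd : forall u v, app f u v -> u ∈ n /\ v ∈ A).
  { intros u v Huv; apply app_iff in Huv; destruct (Hf _ Huv) as (u' & v' & Hu & Hv' & E).
    apply is_opair_iff, opair_inj in E; destruct E; subst; auto. }
  assert (Happ : forall u v, app (adjoin f (opair n x)) u v <->
    app f u v \/ (u = n /\ v = x)).
  { intros u v; rewrite !app_iff, in_adjoin; split.
    - intros [H|H]; [auto|apply opair_inj in H; auto].
    - intros [H|[-> ->]]; auto. }
  pose proof (not_in_self n) as Hnn.
  exists w, (adjoin n n), (adjoin f (opair n x)).
  split; [exact Hw|split; [apply succ_in_omega; assumption|]].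
  split; [split; [split|]|].
  - intros p Hp; apply in_adjoin in Hp; destruct Hp as [Hp|Hp].
    + destruct (Hf p Hp) as (u & v & Hu & Hv' & E); exists u, v.
      rewrite !in_adjoin; auto.
    + exists n, x; rewrite !in_adjoin, is_opair_iff; auto.
  - intros u Hu; apply in_adjoin in Hu; destruct Hu as [Hu|Hu].
    + destruct (Hv u Hu) as (v & Huv & Hun); exists v; split.
      * apply Happ; auto.
      * intros v' H; apply Happ in H; destruct H as [H|[-> _]]; [auto|tauto].
    + subst u; exists x; split; [apply Happ; auto|].
      intros v' H; apply Happ in H; destruct H as [H|[_ H]]; [|auto].
      destruct (Hd _ _ H); tauto.
  - intros u u' v H H'; apply Happ in H; apply Happ in H'.
    destruct H as [H|[H1 H2]], H' as [H'|[H1' H2']]; subst; auto.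
    + exact (Hi _ _ _ H H').
    + destruct (Hd _ _ H); tauto.
    + destruct (Hd _ _ H'); tauto.
  - intros v H; apply in_adjoin in H; destruct H as [H|H].
    + destruct (Hs v H) as [u Hu]; exists u; apply Happ; auto.
    + subst v; exists n; apply Happ; auto.
Qed.

(** Induction on [n], for all sets covered by the values at the elements of
    [n] of a relation single-valued there.  Formulated in this way, the same
    relation serves again when the last element of [n] is dropped. *)
Lemma finite_ind (Q : M -> Prop) : definable Q ->
  (forall a, is_empty a -> Q a) ->
  (forall A x, Q A -> Q (adjoin A x)) ->
  forall A, finite_set A -> Q A.
Proof.
  intros HQ H0 HS A (w & n & f & Hw & Hn & ((Hf & Hv) & _) & Hs).
  set (R := fun n => forall f A,
    (forall y, y ∈ A -> exists x, x ∈ n /\ app f x y) ->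
    (forall x y y', x ∈ n -> app f x y -> app f x y' -> y = y') -> Q A).
  assert (HR : R n).
  { apply (omega_ind w R Hw); [unfold R; definability| | |exact Hn].
    - intros a Ha g B Hc _; apply H0; intros y Hy.
      destruct (Hc y Hy) as (x & Hx & _); exact (Ha x Hx).
    - intros m _ IH g B Hc Hsv.
      set (B' := sep B (fun y => exists x, x ∈ m /\ app g x y)).
      assert (HB' : forall y, y ∈ B' <->
        y ∈ B /\ exists x, x ∈ m /\ app g x y).
      { intros y; apply in_sep; definability. }
      assert (QB' : Q B').
      { apply (IH g).
        - intros y Hy; apply HB' in Hy; apply Hy.
        - intros x y y' Hx; apply Hsv, in_adjoin; auto. }
      destruct (classic (exists y, y ∈ B /\ app g m y)) as [(y0 & Hy0 & Hm)|Hno].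
      + replace B with (adjoin B' y0); [apply HS, QB'|].
        apply extensionality; intros y; rewrite in_adjoin, HB'; split.
        * intros [[H _]| ->]; assumption.
        * intros Hy; destruct (Hc y Hy) as (x & Hx & Hxy).
          apply in_adjoin in Hx; destruct Hx as [Hx| ->]; [left; eauto|right].
          apply (Hsv m); [apply in_adjoin; auto|assumption|assumption].
      + replace B with B'; [exact QB'|].
        apply extensionality; intros y; rewrite HB'; split; [tauto|].
        intros Hy; split; [exact Hy|]; destruct (Hc y Hy) as (x & Hx & Hxy).
        apply in_adjoin in Hx; destruct Hx as [Hx| ->]; [eauto|].
        destruct Hno; eauto. }
  apply (HR f).
  - intros y Hy; destruct (Hs y Hy) as [x Hx]; exists x; split; [|exact Hx].
    apply app_iff in Hx; destruct (Hf _ Hx) as (x' & y' & Hx' & _ & E).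
    apply is_opair_iff, opair_inj in E; destruct E; subst; exact Hx'.
  - intros x y y' Hx H H'; destruct (Hv x Hx) as (v & _ & Hu).
    rewrite <- (Hu _ H), <- (Hu _ H'); reflexivity.
Qed.

Lemma finite_subset A B : finite_set A -> subset B A -> finite_set B.
Proof.
  intros HA; revert B; pattern A; revert A HA; apply finite_ind.
  - definability.
  - intros a Ha B HB; apply finite_empty; intros x Hx; exact (Ha x (HB x Hx)).
  - intros A x IH B HB.
    assert (Hc : finite_set (cap B A)).
    { apply IH; intros y Hy; apply in_cap in Hy; apply Hy. }
    destruct (classic (x ∈ B)) as [Hx|Hx].
    + replace B with (adjoin (cap B A) x); [apply finite_adjoin, Hc|].
      apply extensionality; intros y; rewrite in_adjoin, in_cap; split.
      * intros [[H _]| ->]; assumption.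
      * intros Hy; pose proof (HB y Hy) as Hy'; apply in_adjoin in Hy'; tauto.
    + replace B with (cap B A); [exact Hc|].
      apply extensionality; intros y; rewrite in_cap; split; [tauto|].
      intros Hy; pose proof (HB y Hy) as Hy'; apply in_adjoin in Hy'.
      destruct Hy' as [Hy'| ->]; tauto.
Qed.

Lemma finite_union_closed (J : M -> Prop) V : definable J ->
  (forall a, is_empty a -> J a) ->
  (forall a b, J a -> J b -> J (cup a b)) ->
  finite_set V -> (forall v, v ∈ V -> J v) -> J (union_of V).
Proof.
  intros HJ H0 H2 HV Hall.
  assert (H : (forall v, v ∈ V -> J v) -> exists s, is_union s V /\ J s).
  { clear Hall; pattern V; revert V HV; apply finite_ind.
    - definability.
    - intros a Ha _; exists a; split; [|exact (H0 a Ha)].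
      intros x; split; [intros Hx; destruct (Ha x Hx)|].
      intros (u & Hu & _); destruct (Ha u Hu).
    - intros V v IH Hall; destruct IH as (s & Hs & Js).
      { intros u Hu; apply Hall, in_adjoin; auto. }
      exists (cup s v); split.
      + intros x; rewrite in_cup, (Hs x); split.
        * intros [(u & Hu & Hx)|Hx]; [exists u|exists v]; rewrite in_adjoin; auto.
        * intros (u & Hu & Hx); apply in_adjoin in Hu.
          destruct Hu as [Hu| ->]; [left; eauto|right; exact Hx].
      + apply H2; [exact Js|apply Hall, in_adjoin; auto]. }
  destruct (H Hall) as (s & Hs & Js); rewrite <- (is_union_eq _ _ Hs); exact Js.
Qed.

Lemma finite_cup A B : finite_set A -> finite_set B -> finite_set (cup A B).
Proof.
  intros HA HB.
  assert (H : exists C, is_cup C A B /\ finite_set C).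
  { pattern A; revert A HA; apply finite_ind.
    - definability.
    - intros a Ha; exists B; split; [|exact HB].
      intros x; split; [tauto|intros [Hx|Hx]; [destruct (Ha x Hx)|exact Hx]].
    - intros A x (C & HC & FC); exists (adjoin C x).
      split; [|apply finite_adjoin, FC].
      intros y; rewrite !in_adjoin, (HC y); tauto. }
  destruct H as (C & HC & FC); replace (cup A B) with C; [exact FC|].
  apply extensionality; intros x; rewrite in_cup; apply HC.
Qed.

Lemma finite_upair a b : finite_set (upair a b).
Proof.
  destruct empty_ex as [z Hz].
  replace (upair a b) with (adjoin (adjoin z a) b).
  - apply finite_adjoin, finite_adjoin, finite_empty, Hz.
  - apply extensionality; intros x; rewrite !in_adjoin, in_upair.
    split; [intros [[H|H]|H]; auto; destruct (Hz x H)|tauto].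
Qed.

Lemma finite_union_of V :
  finite_set V -> (forall v, v ∈ V -> finite_set v) -> finite_set (union_of V).
Proof.
  apply (finite_union_closed (fun A => finite_set A)).
  - definability.
  - exact finite_empty.
  - exact finite_cup.
Qed.

Lemma finite_trace_union K V : finite_set V ->
  (forall v, v ∈ V -> finite_set (cap v K)) -> finite_set (cap (union_of V) K).
Proof.
  intros FV HV.
  (* A finite superset instead of the intersection itself keeps the predicate
     visibly definable. *)
  assert (H : exists w, finite_set w /\
    forall x, x ∈ union_of V -> x ∈ K -> x ∈ w).
  { apply (finite_union_closed (fun A => exists w, finite_set w /\
      forall x, x ∈ A -> x ∈ K -> x ∈ w) V); [definability| | |exact FV|].
    - intros a Ha; exists a; split; [exact (finite_empty a Ha)|auto].
    - intros a b (wa & Fa & Ca) (wb & Fb & Cb); exists (cup wa wb).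
      split; [apply finite_cup; assumption|].
      intros x; rewrite !in_cup; intuition.
    - intros v Hv; exists (cap v K); split; [exact (HV v Hv)|].
      intros x; rewrite in_cap; auto. }
  destruct H as (w & Fw & Cw); apply (finite_subset w _ Fw).
  intros x Hx; apply in_cap in Hx; apply Cw; apply Hx.
Qed.

(** The elements of [omega] are transitive sets, so that a finite non-empty set
    of them has a member that belongs to no other one; but every natural number
    belongs to its successor. *)
Lemma omega_not_finite w : is_omega w -> ~ finite_set w.
Proof.
  intros Hw Hfin.
  assert (Htr : forall n, n ∈ w -> forall x, x ∈ n -> subset x n).
  { intros n Hn; pattern n; revert n Hn; apply (omega_ind w); [exact Hw|definability| |].
    - intros a Ha x Hx; destruct (Ha x Hx).
    - intros n _ IH x Hx y Hy; apply in_adjoin in Hx; apply in_adjoin; left.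
      destruct Hx as [Hx| ->]; [exact (IH x Hx y Hy)|exact Hy]. }
  assert (Hmax : forall A, finite_set A -> subset A w -> (exists a, a ∈ A) ->
    exists m, m ∈ A /\ forall x, x ∈ A -> ~ m ∈ x).
  { intros A HA; pattern A; revert A HA; apply finite_ind.
    - definability.
    - intros a Ha _ [x Hx]; destruct (Ha x Hx).
    - intros A x IH HA _.
      assert (Hx : x ∈ w) by (apply HA, in_adjoin; auto).
      assert (HA' : subset A w) by (intros y Hy; apply HA, in_adjoin; auto).
      destruct (classic (exists a, a ∈ A)) as [Hne|Hne].
      + destruct (IH HA' Hne) as (m & Hm & Hmm).
        destruct (classic (m ∈ x)) as [Hmx|Hmx].
        * exists x; split; [apply in_adjoin; auto|].
          intros y Hy Hxy; apply in_adjoin in Hy; destruct Hy as [Hy| ->].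
          -- apply (Hmm y Hy), (Htr y (HA' y Hy) x Hxy), Hmx.
          -- exact (not_in_self _ Hxy).
        * exists m; split; [apply in_adjoin; auto|].
          intros y Hy; apply in_adjoin in Hy; destruct Hy as [Hy| ->]; auto.
      + exists x; split; [apply in_adjoin; auto|].
        intros y Hy; apply in_adjoin in Hy; destruct Hy as [Hy| ->].
        * destruct Hne; eauto.
        * apply not_in_self. }
  destruct (Hmax w Hfin) as (m & Hm & Hmm).
  - intros x Hx; exact Hx.
  - destruct (proj1 (proj1 Hw)) as (z & _ & Hz); eauto.
  - apply (Hmm (adjoin m m)); [apply succ_in_omega; assumption|].
    apply in_adjoin; auto.
Qed.

(** * Families that are essentially finite on a set *)

Definition ess_finite_on K U : Prop :=
  exists V, subset V U /\ finite_set V /\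
    forall x, x ∈ K -> (exists u, u ∈ U /\ x ∈ u) -> exists v, v ∈ V /\ x ∈ v.

Definition ess_finite_families K O : M :=
  sep (power O) (fun U => ess_finite_on K U).

Lemma in_ess_finite_families K O U :
  U ∈ ess_finite_families K O <-> subset U O /\ ess_finite_on K U.
Proof.
  rewrite <- in_power; apply in_sep; unfold ess_finite_on; definability.
Qed.

(** By induction on [V], since the sets whose trace on [K] is covered by a
    finite subfamily of [W] are closed under finite unions. *)
Lemma finite_cover_gather K V W : finite_set V ->
  (forall v, v ∈ V -> exists W0, subset W0 W /\ finite_set W0 /\
     forall x, x ∈ K -> x ∈ v -> exists w, w ∈ W0 /\ x ∈ w) ->
  exists W0, subset W0 W /\ finite_set W0 /\
    forall x, x ∈ K -> x ∈ union_of V -> exists w, w ∈ W0 /\ x ∈ w.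
Proof.
  apply (finite_union_closed (fun A => exists W0, subset W0 W /\ finite_set W0 /\
    forall x, x ∈ K -> x ∈ A -> exists w, w ∈ W0 /\ x ∈ w)).
  - definability.
  - intros a Ha; exists a; split; [|split; [exact (finite_empty a Ha)|]];
      intros x Hx; [destruct (Ha x Hx)|intros Hx'; destruct (Ha x Hx')].
  - intros a b (Wa & Sa & Fa & Ca) (Wb & Sb & Fb & Cb); exists (cup Wa Wb).
    split; [|split; [apply finite_cup; assumption|]].
    + intros x Hx; apply in_cup in Hx; destruct Hx; auto.
    + intros x HK Hx; apply in_cup in Hx; destruct Hx as [Hx|Hx].
      * destruct (Ca x HK Hx) as (w & Hw & Hxw); exists w; rewrite in_cup; auto.
      * destruct (Cb x HK Hx) as (w & Hw & Hxw); exists w; rewrite in_cup; auto.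
Qed.

Lemma finite_ess_finite_on K U : finite_set U -> ess_finite_on K U.
Proof. intros HU; exists U; split; [intros x Hx; exact Hx|auto]. Qed.

(** The common form of restriction, transitivity and saturation for these
    families: in each case the trace on [K] of a member of the given family is
    covered by finitely many members of the new one. *)
Lemma ess_finite_on_refine K U W : ess_finite_on K U ->
  (forall u, u ∈ U -> exists W0, subset W0 W /\ finite_set W0 /\
     forall x, x ∈ K -> x ∈ u -> (exists w, w ∈ W /\ x ∈ w) ->
       exists w, w ∈ W0 /\ x ∈ w) ->
  (forall x, (exists w, w ∈ W /\ x ∈ w) -> exists u, u ∈ U /\ x ∈ u) ->
  ess_finite_on K W.
Proof.
  intros (V & SV & FV & CV) HW HU.
  destruct (finite_cover_gather (cap K (union_of W)) V W FV) as (W0 & S0 & F0 & C0).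
  - intros v Hv; destruct (HW v (SV v Hv)) as (W0 & S0 & F0 & C0); exists W0.
    split; [exact S0|split; [exact F0|]].
    intros x Hx Hxv; apply in_cap in Hx; rewrite in_union_of in Hx.
    apply C0; tauto.
  - exists W0; split; [exact S0|split; [exact F0|]].
    intros x HK Hx; apply C0.
    + apply in_cap; rewrite in_union_of; auto.
    + apply in_union_of, CV; auto.
Qed.

(** Regularity is a condition on the open sets as much as on the admissible
    families, and so it remains as a hypothesis on [O]; the other axioms follow
    from the lattice structure of [O] and from [ess_finite_on_refine]. *)
Lemma is_gts_ess_finite X O K :
  (forall V, V ∈ O -> subset V X) ->
  (forall a, is_empty a -> a ∈ O) ->
  X ∈ O ->
  (forall U V, U ∈ O -> V ∈ O -> cup U V ∈ O) ->
  (forall U V, U ∈ O -> V ∈ O -> cap U V ∈ O) ->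
  (forall U V, subset U O -> ess_finite_on K U -> subset V (union_of U) ->
     (forall u, u ∈ U -> cap V u ∈ O) -> V ∈ O) ->
  is_gts (Triple M X O (ess_finite_families K O)).
Proof.
  intros OX O0 OT Ocup Ocap Oreg; split; simpl.
  - exact OX.
  - intros U HU; apply in_ess_finite_families in HU; apply HU.
  - intros U HUO HU; split; [|split].
    + intros s Hs; rewrite (is_union_eq _ _ Hs).
      apply (finite_union_closed (fun u => u ∈ O)); auto; definability.
    + revert HUO; pattern U; revert U HU; apply finite_ind.
      * unfold is_inter_in; definability.
      * intros a Ha _ s Hs; replace s with X; [exact OT|].
        apply extensionality; intros x; rewrite (Hs x); split; [|tauto].
        intros Hx; split; [exact Hx|intros u Hu; destruct (Ha u Hu)].
      * intros U u IH HUO s Hs.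
        set (t := sep X (fun x => forall v, v ∈ U -> x ∈ v)).
        assert (Ht : is_inter_in X t U).
        { intros x; apply in_sep; definability. }
        replace s with (cap t u).
        -- apply Ocap; [apply IH; [|exact Ht]|apply HUO, in_adjoin; auto].
           intros v Hv; apply HUO, in_adjoin; auto.
        -- apply extensionality; intros x; rewrite in_cap, (Ht x), (Hs x); split.
           ++ intros [[Hx H] Hu]; split; [exact Hx|].
              intros v Hv; apply in_adjoin in Hv; destruct Hv as [Hv| ->]; auto.
           ++ intros [Hx H]; split; [split; [exact Hx|]|].
              ** intros v Hv; apply H, in_adjoin; auto.
              ** apply H, in_adjoin; auto.
    + apply in_ess_finite_families; split; [exact HUO|].
      apply finite_ess_finite_on, HU.
  - intros U V W HU HV HW; apply in_ess_finite_families in HU.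
    destruct HU as [HUO HU]; apply in_ess_finite_families; split.
    + intros w Hw; apply HW in Hw; destruct Hw as (u & Hu & E).
      rewrite (is_cap_eq _ _ _ E); auto.
    + apply (ess_finite_on_refine K U W HU).
      * intros u Hu; exists (upair (cap u V) (cap u V)).
        split; [|split; [apply finite_upair|]].
        -- intros w Hw; apply in_upair in Hw; apply HW; exists u.
           split; [exact Hu|]; destruct Hw; subst w; intros x; apply in_cap.
        -- intros x _ Hxu (w & Hw & Hxw); exists (cap u V).
           rewrite in_upair, in_cap; split; [auto|split; [exact Hxu|]].
           apply HW in Hw; destruct Hw as (u' & _ & E); apply (E x), Hxw.
      * intros x (w & Hw & Hxw); apply HW in Hw; destruct Hw as (u & Hu & E).
        exists u; split; [exact Hu|apply (E x), Hxw].
  - intros U f W HU Hf Hun HW; apply in_ess_finite_families in HU.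
    destruct HU as [HUO HU].
    assert (Hfc : forall u v, app f u v ->
      u ∈ U /\ v ∈ ess_finite_families K O).
    { intros u v H; apply app_iff in H; destruct (proj1 Hf _ H) as (u' & v' & Hu & Hv & E).
      apply is_opair_iff, opair_inj in E; destruct E; subst; auto. }
    apply in_ess_finite_families; split.
    + intros w Hw; apply HW in Hw; destruct Hw as (u & v & Huv & Hwv).
      destruct (Hfc u v Huv) as [_ Hv]; apply in_ess_finite_families in Hv.
      apply Hv, Hwv.
    + apply (ess_finite_on_refine K U W HU).
      * intros u Hu; destruct (proj2 Hf u Hu) as (v & Huv & _).
        destruct (Hfc u v Huv) as [_ Hv]; apply in_ess_finite_families in Hv.
        destruct Hv as [_ (V & SV & FV & CV)]; exists V.
        split; [|split; [exact FV|]].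
        -- intros w Hw; apply HW; eauto.
        -- intros x HK Hx _; apply CV; [exact HK|apply (Hun u v Huv), Hx].
      * intros x (w & Hw & Hxw); apply HW in Hw; destruct Hw as (u & v & Huv & Hwv).
        exists u; split; [apply (Hfc u v Huv)|apply (Hun u v Huv); eauto].
  - intros U V HUO HV (s & HsV & HsU) Href; apply in_ess_finite_families in HV.
    apply in_ess_finite_families; split; [exact HUO|].
    apply (ess_finite_on_refine K V U); [apply HV| |].
    + intros v Hv; destruct (Href v Hv) as (u & Hu & Hvu); exists (upair u u).
      split; [|split; [apply finite_upair|]].
      * intros w Hw; apply in_upair in Hw; destruct Hw; subst; exact Hu.
      * intros x _ Hx _; exists u; rewrite in_upair; auto.
    + intros x Hx; apply (HsV x), (HsU x), Hx.
  - intros U V HU HV Hreg; apply in_ess_finite_families in HU.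
    apply (Oreg U V); [apply HU|apply HU| |].
    + intros x Hx; apply in_union_of; auto.
    + intros u Hu; apply (Hreg u _ Hu); intros x; apply in_cap.
Qed.

(** By induction on [K]: a new point asks for at most one more member. *)
Lemma finite_small (G : triple M) K :
  subset K (space G) -> finite_set K -> small G K.
Proof.
  intros HK FK; split; [exact HK|]; intros U _; clear HK.
  pattern K; revert K FK; apply finite_ind.
  - definability.
  - intros a Ha; exists a; split; [|split; [exact (finite_empty a Ha)|]];
      intros x Hx; destruct (Ha x Hx).
  - intros K x (V & SV & FV & CV).
    destruct (classic (exists u, u ∈ U /\ x ∈ u)) as [(u & Hu & Hxu)|Hno].
    + exists (adjoin V u); split; [|split; [apply finite_adjoin, FV|]].
      * intros v Hv; apply in_adjoin in Hv; destruct Hv as [Hv| ->]; auto.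
      * intros y Hy Hyu; apply in_adjoin in Hy; destruct Hy as [Hy| ->].
        -- destruct (CV y Hy Hyu) as (v & Hv & Hyv); exists v.
           rewrite in_adjoin; auto.
        -- exists u; rewrite in_adjoin; auto.
    + exists V; split; [exact SV|split; [exact FV|]].
      intros y Hy Hyu; apply in_adjoin in Hy; destruct Hy as [Hy| ->]; auto.
      destruct (Hno Hyu).
Qed.

(** * A weakly locally small space that is not locally small *)

Section Example.

Context (Y Z : M).
Context (Y_infinite : ~ finite_set Y).
Context (YZ_disjoint : forall x, x ∈ Y -> ~ x ∈ Z).
Context (Z_finite : forall z, z ∈ Z -> finite_set z).
Context (Y_covered : forall y, y ∈ Y -> exists z, z ∈ Z /\ y ∈ z).

Definition points : M := cup Y Z.

(** The topology in which the smallest neighbourhood of a point [z] of [Z]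
    consists of [z] and of the elements of [z] in [Y]; the points of [Y] are
    isolated. *)
Definition attached_opens : M :=
  sep (power points)
    (fun V => forall z y, z ∈ V -> z ∈ Z -> y ∈ z -> y ∈ Y -> y ∈ V).

Definition thin_opens : M :=
  sep attached_opens
    (fun V => (exists w, is_cap w V Z /\ finite_set w) \/ V = points).

Definition singletons A : M :=
  sep (power A) (fun s => exists y, y ∈ A /\ is_upair s y y).

Definition thin_gts : triple M :=
  Triple M points thin_opens (ess_finite_families Z thin_opens).

Definition attached_gts : triple M :=
  Triple M points attached_opens (ess_finite_families Z attached_opens).

Lemma in_attached_opens V : V ∈ attached_opens <->
  subset V points /\ forall z y, z ∈ V -> z ∈ Z -> y ∈ z -> y ∈ Y -> y ∈ V.
Proof.
  rewrite <- in_power; apply (in_sep (power points)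
    (fun V => forall z y, z ∈ V -> z ∈ Z -> y ∈ z -> y ∈ Y -> y ∈ V)).
  definability.
Qed.

Lemma in_thin_opens V : V ∈ thin_opens <->
  V ∈ attached_opens /\ (finite_set (cap V Z) \/ V = points).
Proof.
  unfold thin_opens; rewrite in_sep; [|definability].
  enough ((exists w, is_cap w V Z /\ finite_set w) <-> finite_set (cap V Z)) by tauto.
  split.
  - intros (w & E & Hw); rewrite <- (is_cap_eq _ _ _ E); exact Hw.
  - intros H; exists (cap V Z); split; [intros x; apply in_cap|exact H].
Qed.

Lemma in_singletons A s : s ∈ singletons A <-> exists y, y ∈ A /\ s = upair y y.
Proof.
  unfold singletons; rewrite in_sep; [|definability]; split.
  - intros (_ & y & Hy & E); exists y; split; [exact Hy|apply is_upair_eq, E].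
  - intros (y & Hy & ->); rewrite in_power; split.
    + intros x Hx; apply in_upair in Hx; destruct Hx; subst; exact Hy.
    + exists y; split; [exact Hy|intros x; apply in_upair].
Qed.

Lemma thin_attached V : V ∈ thin_opens -> V ∈ attached_opens.
Proof. intros H; apply in_thin_opens in H; apply H. Qed.

Lemma attached_empty a : is_empty a -> a ∈ attached_opens.
Proof.
  intros Ha; apply in_attached_opens; split; [intros x Hx|intros z y Hx];
    destruct (Ha _ Hx).
Qed.

Lemma attached_points : points ∈ attached_opens.
Proof.
  apply in_attached_opens; split; [intros x Hx; exact Hx|].
  intros z y _ _ _ Hy; apply in_cup; auto.
Qed.

Lemma attached_union U : subset U attached_opens -> union_of U ∈ attached_opens.
Proof.
  intros HU; apply in_attached_opens; split.
  - intros x Hx; apply in_union_of in Hx; destruct Hx as (u & Hu & Hx).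
    apply HU, in_attached_opens in Hu; apply Hu, Hx.
  - intros z y Hz HzZ Hyz Hy; apply in_union_of in Hz; destruct Hz as (u & Hu & Hz).
    apply in_union_of; exists u; split; [exact Hu|].
    apply HU, in_attached_opens in Hu; apply (proj2 Hu z y Hz HzZ Hyz Hy).
Qed.

Lemma attached_cup U V :
  U ∈ attached_opens -> V ∈ attached_opens -> cup U V ∈ attached_opens.
Proof.
  intros HU HV; apply attached_union; intros x Hx; apply in_upair in Hx.
  destruct Hx; subst; assumption.
Qed.

Lemma attached_cap U V :
  U ∈ attached_opens -> V ∈ attached_opens -> cap U V ∈ attached_opens.
Proof.
  intros HU HV; apply in_attached_opens in HU; apply in_attached_opens in HV.
  apply in_attached_opens; split.
  - intros x Hx; apply in_cap in Hx; apply HU, Hx.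
  - intros z y Hz HzZ Hyz Hy; apply in_cap in Hz; apply in_cap; split.
    + apply (proj2 HU z y); tauto.
    + apply (proj2 HV z y); tauto.
Qed.

Lemma attached_local U V : subset V (union_of U) ->
  (forall u, u ∈ U -> cap V u ∈ attached_opens) -> V ∈ attached_opens.
Proof.
  intros HVU HU.
  replace V with (union_of (sep (power V)
    (fun w => exists u, u ∈ U /\ is_cap w V u))).
  - apply attached_union; intros w Hw; apply in_sep in Hw; [|definability].
    destruct Hw as (_ & u & Hu & E); rewrite (is_cap_eq _ _ _ E); auto.
  - apply extensionality; intros x; rewrite in_union_of; split.
    + intros (w & Hw & Hx); apply in_sep in Hw; [|definability].
      destruct Hw as [Hw _]; apply in_power in Hw; exact (Hw x Hx).
    + intros Hx; pose proof (HVU x Hx) as HxU; apply in_union_of in HxU.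
      destruct HxU as (u & Hu & Hxu); exists (cap V u); split.
      * apply in_sep; [definability|split].
        -- apply in_power; intros y Hy; apply in_cap in Hy; apply Hy.
        -- exists u; split; [exact Hu|intros y; apply in_cap].
      * apply in_cap; auto.
Qed.

Lemma thin_of_finite V : V ∈ attached_opens -> finite_set V -> V ∈ thin_opens.
Proof.
  intros HV HF; apply in_thin_opens; split; [exact HV|left].
  apply (finite_subset V); [exact HF|intros x Hx; apply in_cap in Hx; apply Hx].
Qed.

(** The smallest neighbourhood of a point is finite, since each member of [Z]
    is a finite set. *)
Lemma finite_neighbourhood V x : V ∈ attached_opens -> x ∈ V ->
  exists N, N ∈ thin_opens /\ finite_set N /\ x ∈ N /\ subset N V.
Proof.
  intros HV Hx; apply in_attached_opens in HV; destruct HV as [HVX HV].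
  destruct (classic (x ∈ Z)) as [HZ|HZ].
  - assert (HF : finite_set (adjoin (cap x Y) x)).
    { apply finite_adjoin, (finite_subset x); [auto|].
      intros y Hy; apply in_cap in Hy; apply Hy. }
    assert (HN : subset (adjoin (cap x Y) x) V).
    { intros y Hy; apply in_adjoin in Hy; rewrite in_cap in Hy.
      destruct Hy as [[Hyx Hy]| ->]; [apply (HV x); assumption|exact Hx]. }
    exists (adjoin (cap x Y) x); split; [apply thin_of_finite; [|exact HF]|].
    + apply in_attached_opens; split; [intros y Hy; apply HVX, HN, Hy|].
      intros z y Hz HzZ Hyz Hy; apply in_adjoin in Hz; rewrite in_cap in Hz.
      apply in_adjoin; rewrite in_cap; left.
      destruct Hz as [[_ Hz]| ->]; [destruct (YZ_disjoint z Hz HzZ)|auto].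
    + split; [exact HF|split; [apply in_adjoin; auto|exact HN]].
  - assert (HN : subset (upair x x) V).
    { intros y Hy; apply in_upair in Hy; destruct Hy; subst; exact Hx. }
    exists (upair x x); split; [apply thin_of_finite; [|apply finite_upair]|].
    + apply in_attached_opens; split; [intros y Hy; apply HVX, HN, Hy|].
      intros z y Hz HzZ; apply in_upair in Hz.
      destruct Hz; subst z; contradiction.
    + split; [apply finite_upair|split; [apply in_upair; auto|exact HN]].
Qed.

Lemma attached_is_topology : topology points attached_opens.
Proof.
  split; [|split; [exact attached_points|split]].
  - intros U HU; apply in_attached_opens in HU; apply HU.
  - intros U V W HU HV E; rewrite (is_cap_eq _ _ _ E); apply attached_cap; assumption.
  - intros U s HU E; rewrite (is_union_eq _ _ E); apply attached_union, HU.
Qed.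

(** An open set is the union of the finite open sets that it contains, and these
    are thin. *)
Lemma attached_generated :
  is_generated_topology points thin_opens attached_opens.
Proof.
  split; [exact attached_is_topology|split; [exact thin_attached|]].
  intros T (_ & _ & _ & HT) HO V HV.
  apply (HT (sep thin_opens (fun N => subset N V))).
  - intros N HN; apply in_sep in HN; [|definability]; apply HO, HN.
  - intros x; split.
    + intros Hx; destruct (finite_neighbourhood V x HV Hx) as (N & HN & _ & HxN & HNV).
      exists N; split; [apply in_sep; [definability|auto]|exact HxN].
    + intros (N & HN & Hx); apply in_sep in HN; [|definability]; apply HN, Hx.
Qed.

Lemma attached_gts_is_gts : is_gts attached_gts.
Proof.
  apply is_gts_ess_finite.
  - intros U HU; apply in_attached_opens in HU; apply HU.
  - exact attached_empty.
  - exact attached_points.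
  - exact attached_cup.
  - exact attached_cap.
  - intros U V _ _; apply attached_local.
Qed.

(** Regularity, for [V] cut by an admissible family [U] into thin open sets: if
    one of the pieces is the whole space, so is [V]; otherwise the finitely many
    members of [U] that cover the trace of [V] on [Z] each meet it in a finite
    set. *)
Lemma thin_gts_is_gts : is_gts thin_gts.
Proof.
  apply is_gts_ess_finite.
  - intros U HU; apply thin_attached, in_attached_opens in HU; apply HU.
  - intros a Ha; apply thin_of_finite; [apply attached_empty, Ha|].
    apply finite_empty, Ha.
  - apply in_thin_opens; split; [exact attached_points|auto].
  - intros U V HU HV; apply in_thin_opens in HU; apply in_thin_opens in HV.
    destruct HU as [HU HU'], HV as [HV HV'].
    apply in_thin_opens; split; [apply attached_cup; assumption|].
    apply in_attached_opens in HU; apply in_attached_opens in HV.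
    destruct HU' as [HU'| ->]; [destruct HV' as [HV'| ->]|]; [left|right|right].
    + apply (finite_subset (cup (cap U Z) (cap V Z))); [apply finite_cup; assumption|].
      intros x; rewrite in_cap, !in_cup, !in_cap; tauto.
    + apply extensionality; intros x; rewrite in_cup; split; [|auto].
      intros [H|H]; [apply HU, H|exact H].
    + apply extensionality; intros x; rewrite in_cup; split; [|auto].
      intros [H|H]; [exact H|apply HV, H].
  - intros U V HU HV; apply in_thin_opens in HU; apply in_thin_opens in HV.
    destruct HU as [HU HU'], HV as [HV HV'].
    apply in_thin_opens; split; [apply attached_cap; assumption|].
    destruct HU' as [HU'| ->]; [|destruct HV' as [HV'| ->]].
    + left; apply (finite_subset _ _ HU'); intros x; rewrite !in_cap; tauto.
    + left; apply (finite_subset _ _ HV'); intros x; rewrite !in_cap; tauto.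
    + right; apply extensionality; intros x; rewrite in_cap; tauto.
  - intros U V HU (V0 & SV & FV & CV) HVU Hloc.
    assert (HV : V ∈ attached_opens).
    { apply (attached_local U V HVU); intros u Hu; apply thin_attached, Hloc, Hu. }
    apply in_thin_opens; split; [exact HV|].
    destruct (classic (exists u, u ∈ U /\ cap V u = points)) as [(u & Hu & E)|Hno].
    + right; apply extensionality; intros x; split.
      * apply in_attached_opens in HV; apply HV.
      * rewrite <- E, in_cap; tauto.
    + left.
      apply (finite_subset (cap (union_of V0) (cap V Z))).
      * apply finite_trace_union; [exact FV|]; intros v Hv.
        pose proof (Hloc v (SV v Hv)) as Hf; apply in_thin_opens in Hf.
        destruct Hf as [_ [Hf|Hf]]; [|destruct Hno; eauto].
        apply (finite_subset _ _ Hf); intros x; rewrite !in_cap; tauto.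
      * intros x Hx; apply in_cap; split; [|exact Hx]; apply in_cap in Hx.
        apply in_union_of, CV; [tauto|].
        apply in_union_of, HVU; tauto.
Qed.

(** The singletons do not meet [Z], so the empty subfamily suffices. *)
Lemma singletons_admissible A :
  subset A Y -> singletons A ∈ ess_finite_families Z thin_opens.
Proof.
  intros HA; apply in_ess_finite_families; split.
  - intros s Hs; apply in_singletons in Hs; destruct Hs as (y & Hy & ->).
    apply thin_of_finite; [|apply finite_upair]; apply in_attached_opens; split.
    + intros x Hx; apply in_upair in Hx; apply in_cup; left.
      destruct Hx; subst; auto.
    + intros z x Hz HzZ; apply in_upair in Hz; destruct (YZ_disjoint y); auto.
      destruct Hz; subst; exact HzZ.
  - destruct empty_ex as [a Ha]; exists a.
    split; [intros x Hx; destruct (Ha x Hx)|split; [apply finite_empty, Ha|]].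
    intros x HxZ (s & Hs & Hx); apply in_singletons in Hs.
    destruct Hs as (y & Hy & ->); apply in_upair in Hx.
    destruct (YZ_disjoint x); [destruct Hx; subst; auto|exact HxZ].
Qed.

Lemma union_singletons A : union_of (singletons A) = A.
Proof.
  apply extensionality; intros x; rewrite in_union_of; split.
  - intros (s & Hs & Hx); apply in_singletons in Hs; destruct Hs as (y & Hy & ->).
    apply in_upair in Hx; destruct Hx; subst; exact Hy.
  - intros Hx; exists (upair x x); rewrite in_singletons, in_upair; eauto.
Qed.

Lemma ess_finite_families_mono K O O' : subset O O' ->
  subset (ess_finite_families K O) (ess_finite_families K O').
Proof.
  intros H U HU; apply in_ess_finite_families in HU; apply in_ess_finite_families.
  split; [intros u Hu; apply H|]; apply HU; assumption.
Qed.

(** For [U] essentially finite on [Z], let [B] be the union of a finite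
    subfamily that covers the points of [Z] in the union of [U], and [A] the
    rest of this union.  As [A] is contained in [Y], the singletons of its
    points form an admissible family of thin open sets.  Thus [U] is refined over
    [B] by a finite family, over [A] by singletons, and {A, B} is finite. *)
Lemma attached_covers_generated P E :
  is_ess_fin E attached_opens -> is_cup P (covers thin_gts) E ->
  is_generated_gtop points P (covers attached_gts).
Proof.
  intros HE HP; split; [exists attached_opens; exact attached_gts_is_gts|split].
  - intros U HU; apply HP in HU; destruct HU as [HU|HU].
    + exact (ess_finite_families_mono Z _ _ thin_attached U HU).
    + apply HE in HU; destruct HU as (HU & V & SV & FV & s & HsV & HsU).
      apply in_ess_finite_families; split; [exact HU|].
      exists V; split; [exact SV|split; [exact FV|]].
      intros x _ Hx; apply (HsV x), (HsU x), Hx.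
  - intros C (O & HC) HPC U HU; apply in_ess_finite_families in HU.
    destruct HU as (HU & V & SV & FV & CV).
    assert (HEC : forall U, subset U attached_opens -> finite_set U -> U ∈ C).
    { intros W HW FW; apply HPC, HP; right; apply HE; split; [exact HW|].
      exists W; split; [intros x Hx; exact Hx|split; [exact FW|]].
      exists (union_of W); split; intros x; apply in_union_of. }
    assert (HTO : subset attached_opens O).
    { intros W HW; apply (gts_covers_subset HC (upair W W)); simpl.
      - apply HEC; [|apply finite_upair].
        intros x Hx; apply in_upair in Hx; destruct Hx; subst; exact HW.
      - apply in_upair; auto. }
    pose proof (gts_saturated HC) as Hsat; simpl in Hsat.
    set (B := union_of V).
    set (A := sep (union_of U) (fun x => ~ x ∈ B)).
    assert (HA : forall x, x ∈ A <-> x ∈ union_of U /\ ~ x ∈ B).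
    { intros x; apply in_sep; definability. }
    assert (HBT : B ∈ attached_opens).
    { apply attached_union; intros v Hv; apply HU, SV, Hv. }
    assert (HAY : subset A Y).
    { intros x Hx; apply HA in Hx; destruct Hx as [HxU HxB].
      assert (Hx : x ∈ points).
      { pose proof (attached_union U HU) as H; apply in_attached_opens in H.
        apply H, HxU. }
      apply in_cup in Hx; destruct Hx as [Hx|Hx]; [exact Hx|].
      destruct HxB; apply in_union_of, CV; [exact Hx|apply in_union_of, HxU]. }
    assert (HAT : A ∈ attached_opens).
    { rewrite <- (union_singletons A); apply attached_union; intros s Hs.
      pose proof (singletons_admissible A HAY) as H.
      apply in_ess_finite_families in H; apply thin_attached, H, Hs. }
    (* Transitivity takes a function of the members of the cover.  The family
       of all open subsets of u that refine U depends on u alone, so there is no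
       conflict when A and B coincide, being both empty. *)
    set (R := fun u => sep attached_opens
      (fun t => subset t u /\ exists u', u' ∈ U /\ subset t u')).
    assert (HR : forall u t, t ∈ R u <->
      t ∈ attached_opens /\ subset t u /\ exists u', u' ∈ U /\ subset t u').
    { intros u t; apply in_sep; definability. }
    assert (HRun : forall u W, W ∈ C -> union_of W = u -> subset W (R u) ->
      R u ∈ C /\ is_union u (R u)).
    { intros u W HW HWu HWR.
      assert (Hu : is_union u (R u)).
      { intros x; split.
        - rewrite <- HWu at 1; rewrite in_union_of.
          intros (w & Hw & Hx); exists w; auto.
        - intros (t & Ht & Hx); apply HR in Ht; apply Ht, Hx. }
      split; [|exact Hu]; apply (Hsat (R u) W).
      - intros t Ht; apply HR in Ht; apply HTO, Ht.
      - exact HW.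
      - exists u; split; [|exact Hu]; intros x; rewrite <- HWu at 1; apply in_union_of.
      - intros w Hw; exists w; split; [auto|intros x Hx; exact Hx]. }
    assert (HRB : R B ∈ C /\ is_union B (R B)).
    { apply (HRun B V); [|reflexivity|].
      - apply HEC; [|exact FV]; intros v Hv; apply HU, SV, Hv.
      - intros v Hv; apply HR; split; [apply HU, SV, Hv|split].
        + intros x Hx; apply in_union_of; eauto.
        + exists v; split; [apply SV, Hv|intros x Hx; exact Hx]. }
    assert (HRA : R A ∈ C /\ is_union A (R A)).
    { apply (HRun A (singletons A)); [|apply union_singletons|].
      - apply HPC, HP; left; apply singletons_admissible, HAY.
      - intros s Hs; pose proof (singletons_admissible A HAY) as H.
        apply in_ess_finite_families in H; apply HR.
        split; [apply thin_attached, H, Hs|].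
        apply in_singletons in Hs; destruct Hs as (y & Hy & ->); split.
        + intros x Hx; apply in_upair in Hx; destruct Hx; subst; exact Hy.
        + apply HA in Hy; rewrite in_union_of in Hy; destruct Hy as [(u & Hu & Hy) _].
          exists u; split; [exact Hu|].
          intros x Hx; apply in_upair in Hx; destruct Hx; subst; exact Hy. }
    assert (Hc : forall u, u ∈ upair A B -> R u ∈ C /\ is_union u (R u)).
    { intros u Hu; apply in_upair in Hu; destruct Hu; subst u; assumption. }
    set (f := upair (opair A (R A)) (opair B (R B))).
    assert (Hf : forall u v, app f u v <-> u ∈ upair A B /\ v = R u).
    { intros u v; unfold f; rewrite app_iff, !in_upair; split.
      - intros [H|H]; apply opair_inj in H; destruct H; subst; auto.
      - intros [[H|H] H']; subst; auto. }
    set (W := cup (R A) (R B)).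
    assert (HW : W ∈ C).
    { apply (gts_transitive HC (U := upair A B) (f := f)); simpl.
      - apply HEC; [|apply finite_upair].
        intros x Hx; apply in_upair in Hx; destruct Hx; subst; assumption.
      - split.
        + intros p Hp; apply in_upair in Hp; destruct Hp as [-> | ->].
          * exists A, (R A); rewrite in_upair, is_opair_iff; intuition.
          * exists B, (R B); rewrite in_upair, is_opair_iff; intuition.
        + intros u Hu; exists (R u); split; [apply Hf; auto|].
          intros v Hv; apply Hf in Hv; symmetry; apply Hv.
      - intros u v Huv; apply Hf in Huv; destruct Huv as [Hu ->]; apply Hc, Hu.
      - intros w; unfold W; rewrite in_cup; split.
        + intros [H|H]; [exists A, (R A)|exists B, (R B)];
            rewrite Hf, in_upair; auto.
        + intros (u & v & Huv & Hw); apply Hf in Huv; rewrite in_upair in Huv.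
          destruct Huv as [[->| ->] ->]; auto. }
    apply (Hsat U W); [intros u Hu; apply HTO, HU, Hu|exact HW| |].
    + exists (union_of U); split; [|intros x; apply in_union_of].
      intros x; split.
      * intros Hx; destruct (classic (x ∈ B)) as [HxB|HxB].
        -- apply HRB in HxB; destruct HxB as (t & Ht & Hxt); exists t.
           split; [apply in_cup; auto|exact Hxt].
        -- assert (HxA : x ∈ A) by (apply HA; auto).
           apply HRA in HxA; destruct HxA as (t & Ht & Hxt); exists t.
           split; [apply in_cup; auto|exact Hxt].
      * intros (t & Ht & Hx); apply in_union_of; apply in_cup in Ht.
        rewrite !HR in Ht.
        destruct Ht as [(_ & _ & u & Hu & Htu)|(_ & _ & u & Hu & Htu)]; eauto.
    + intros t Ht; apply in_cup in Ht; rewrite !HR in Ht; tauto.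
Qed.

Lemma attached_is_partial_topologization :
  is_partial_topologization thin_gts attached_gts.
Proof.
  split; [reflexivity|split; [exact attached_generated|]].
  set (E := sep (power attached_opens) (fun U => exists V, subset V U /\
    finite_set V /\ exists s, is_union s V /\ is_union s U)).
  assert (HE : is_ess_fin E attached_opens).
  { intros U; rewrite <- in_power; apply in_sep; definability. }
  assert (HP : is_cup (cup (covers thin_gts) E) (covers thin_gts) E).
  { intros x; apply in_cup. }
  exists E, (cup (covers thin_gts) E); split; [exact HE|split; [exact HP|]].
  exact (attached_covers_generated _ _ HE HP).
Qed.

Lemma Z_not_finite : ~ finite_set Z.
Proof.
  intros HZ; apply Y_infinite, (finite_subset (union_of Z)).
  - apply finite_union_of; assumption.
  - intros y Hy; apply in_union_of; auto.
Qed.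

(** Removing a single point of [Z] from the space leaves a set open in the
    topology, but neither the whole space nor of finite trace on [Z]. *)
Lemma thin_opens_neq : attached_opens <> thin_opens.
Proof.
  intros E.
  assert (Hz : exists z0, z0 ∈ Z).
  { apply NNPP; intros H; apply Z_not_finite, finite_empty.
    intros z Hz; destruct H; eauto. }
  destruct Hz as [z0 Hz0].
  set (V := sep points (fun x => x <> z0)).
  assert (HV : forall x, x ∈ V <-> x ∈ points /\ x <> z0).
  { intros x; apply in_sep; definability. }
  assert (HVt : V ∈ thin_opens).
  { rewrite <- E; apply in_attached_opens; split; [intros x Hx; apply HV, Hx|].
    intros z y _ _ _ Hy; apply HV; split; [apply in_cup; auto|].
    intros ->; exact (YZ_disjoint z0 Hy Hz0). }
  apply in_thin_opens in HVt; destruct HVt as [_ [HF|HX]].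
  - apply Z_not_finite, (finite_subset (adjoin (cap V Z) z0)).
    + apply finite_adjoin, HF.
    + intros z Hz; rewrite in_adjoin, in_cap, (HV z); unfold points; rewrite in_cup.
      destruct (classic (z = z0)); auto.
  - assert (Hz : z0 ∈ V) by (rewrite HX; apply in_cup; auto).
    apply HV in Hz; tauto.
Qed.

Lemma weakly_locally_small_of_finite (G : triple M) : space G = points ->
  (forall N, N ∈ opens G -> subset N points) -> subset thin_opens (opens G) ->
  weakly_locally_small G.
Proof.
  intros HX HO Hthin; exists (sep thin_opens (fun N => finite_set N)); split.
  - intros N HN; apply in_sep in HN; [|definability]; destruct HN as [HN FN].
    split; [auto|apply finite_small; [rewrite HX; auto|exact FN]].
  - rewrite HX; intros x; split.
    + intros Hx.
      destruct (finite_neighbourhood points x attached_points Hx) as (N & HN & FN & HxN & _).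
      exists N; split; [apply in_sep; [definability|auto]|exact HxN].
    + intros (N & HN & Hx); apply in_sep in HN; [|definability].
      apply (HO N); [apply Hthin, HN|exact Hx].
Qed.

(** The singletons of points of [Y] form an admissible family, so a small set
    has a finite trace on [Y].  An admissible cover by small open sets would
    have finitely many members that cover [Z]; these contain [Y], since each
    point of [Z] drags its elements into every open set around it. *)
Lemma not_locally_small (G : triple M) : space G = points ->
  subset (covers G) (ess_finite_families Z attached_opens) ->
  singletons Y ∈ covers G -> ~ locally_small G.
Proof.
  intros HX HC HY (U & HU & Hsm & HUX); apply HC, in_ess_finite_families in HU.
  destruct HU as (HUT & V & SV & FV & CV).
  assert (Htr : forall u, u ∈ U -> finite_set (cap u Y)).
  { intros u Hu; destruct (proj2 (Hsm u Hu) _ HY) as (S & SS & FS & CS).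
    apply (finite_subset (union_of S)).
    - apply finite_union_of; [exact FS|]; intros s Hs.
      apply SS, in_singletons in Hs; destruct Hs as (y & _ & ->); apply finite_upair.
    - intros x Hx; apply in_cap in Hx; destruct Hx as [Hxu HxY].
      apply in_union_of, CS; [exact Hxu|].
      apply in_union_of; rewrite union_singletons; exact HxY. }
  apply Y_infinite, (finite_subset (cap (union_of V) Y)).
  { apply finite_trace_union; [exact FV|auto]. }
  intros y Hy; apply in_cap; split; [|exact Hy].
  destruct (Y_covered y Hy) as (z & Hz & Hyz).
  destruct (CV z Hz) as (v & Hv & Hzv).
  { apply (HUX z); rewrite HX; apply in_cup; auto. }
  apply in_union_of; exists v; split; [exact Hv|].
  pose proof (HUT v (SV v Hv)) as Hvt; apply in_attached_opens in Hvt.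
  exact (proj2 Hvt z y Hzv Hz Hyz Hy).
Qed.

Lemma example_spec :
  is_gts thin_gts /\
  is_partial_topologization thin_gts attached_gts /\
  thin_gts <> attached_gts /\
  (weakly_locally_small thin_gts /\ ~ locally_small thin_gts) /\
  (weakly_locally_small attached_gts /\ ~ locally_small attached_gts).
Proof.
  assert (HY : subset Y Y) by (intros y Hy; exact Hy).
  split; [exact thin_gts_is_gts|].
  split; [exact attached_is_partial_topologization|].
  split; [intros E; apply thin_opens_neq; exact (eq_sym (f_equal (opens (M:=M)) E))|].
  assert (Hmono : subset (ess_finite_families Z thin_opens)
                         (ess_finite_families Z attached_opens)).
  { exact (ess_finite_families_mono Z _ _ thin_attached). }
  split; split.
  - apply weakly_locally_small_of_finite; [reflexivity| |intros N HN; exact HN].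
    apply (gts_opens_subset thin_gts_is_gts).
  - apply not_locally_small; [reflexivity|exact Hmono|].
    apply singletons_admissible, HY.
  - apply weakly_locally_small_of_finite; [reflexivity| |exact thin_attached].
    apply (gts_opens_subset attached_gts_is_gts).
  - apply not_locally_small; [reflexivity|intros U HU; exact HU|].
    apply Hmono, singletons_admissible, HY.
Qed.

End Example.

(** A pair {Y, a} is no element of [Y], as [Y] belongs to it. *)
Lemma example_ex : exists Y Z,
  ~ finite_set Y /\ (forall x, x ∈ Y -> ~ x ∈ Z) /\
  (forall z, z ∈ Z -> finite_set z) /\
  (forall y, y ∈ Y -> exists z, z ∈ Z /\ y ∈ z).
Proof.
  destruct omega_ex as [Y HY].
  set (Z := sep (power (adjoin Y Y)) (fun z => exists a, a ∈ Y /\ is_upair z Y a)).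
  assert (HZ : forall z, z ∈ Z <-> exists a, a ∈ Y /\ z = upair Y a).
  { intros z; unfold Z; rewrite in_sep; [|definability]; split.
    - intros (_ & a & Ha & E); exists a; split; [exact Ha|apply is_upair_eq, E].
    - intros (a & Ha & ->); rewrite in_power; split.
      + intros x Hx; apply in_upair in Hx; apply in_adjoin.
        destruct Hx; subst; auto.
      + exists a; split; [exact Ha|intros x; apply in_upair]. }
  exists Y, Z; split; [apply omega_not_finite, HY|split; [|split]].
  - intros x Hx HxZ; apply HZ in HxZ; destruct HxZ as (a & _ & ->).
    apply (not_in_cycle _ _ Hx), in_upair; auto.
  - intros z Hz; apply HZ in Hz; destruct Hz as (a & _ & ->); apply finite_upair.
  - intros y Hy; exists (upair Y y); rewrite HZ, in_upair; eauto.
Qed.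

End Model.

Theorem corollary3p9 (M : set_structure) (hZF : ZF M)
    (hCC : countable_choice M) :
  exists X Xpt : triple M,
    is_gts X /\
    is_partial_topologization X Xpt /\
    X <> Xpt /\
    (weakly_locally_small X /\ ~ locally_small X) /\
    (weakly_locally_small Xpt /\ ~ locally_small Xpt).
Proof.
  destruct (example_ex hZF) as (Y & Z & HY & HYZ & HZ & HYc).
  exists (thin_gts Y Z), (attached_gts Y Z).
  apply example_spec; assumption.
Qed.
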